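(* Fix $\gamma>0$ and, for $0<\epsilon<1$, let $T=T(\epsilon)$ be given by $\gamma=\epsilon\sqrt T$. Let $u$ be the function defined in the context with $$\sigma=2\epsilon\Big/\log\Big(\frac{1+\epsilon}{1-\epsilon}\Big),\qquad b=\frac1\epsilon .$$ Then $$\lim_{\epsilon\to0}\frac1{\sqrt T}\,u(0,(\epsilon T,\epsilon T),-T)=\frac1{\sqrt\pi}e^{-\gamma^2}+\gamma\,\mathrm{erf}(\gamma)+\Big(\frac1\gamma-\gamma\Big)\mathrm{erf}\Big(\frac{\gamma}{\sqrt2}\Big)-\sqrt{\frac2\pi}\,e^{-\gamma^2/2}.$$
   Context: $\mathrm{erf}(y)=\frac2{\sqrt\pi}\int_0^ye^{-s^2}ds$. With $\kappa=1-\epsilon^2$ and parameters $\sigma,b>0$, for $\eta\in\mathbb R$, $\xi=(\xi^h,\xi^r)\in\mathbb R^2$, $t<0$ let $$u(\eta,\xi,t)=u^h(\eta,\xi^r+\xi^h,t)+u^n(\xi^r,t),$$ $$u^h(\eta,z,t)=\frac12\Big(\eta+\int_{\mathbb R}\Phi(z-s,2t)|s|\,ds\Big),\qquad \Phi(s,t)=\frac1{\sqrt{-2\pi\kappa t}}\exp\Big(\frac{s^2}{2\kappa t}\Big),$$ $$u^n(\xi^r,t)=\varphi(\xi^r+\epsilon t)-\hat\varphi(\xi^r,t),\qquad \hat\varphi(\xi^r,t)=\int_{\mathbb R}\Phi(\xi^r-s,t)\varphi(s)\,ds,$$ with $\varphi(y)=-y$ for $y\le0$ and $\varphi(y)=y+b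 e^{-2\epsilon y/\sigma}-b$ for $y>0$. (Here $\Phi$ uses $\kappa$, while $\varphi$ uses $\sigma$.) *)

(* Defs.v *)
From mathcomp Require Import all_boot all_order all_algebra.
From mathcomp Require Import all_classical all_reals all_analysis.

Set Implicit Arguments.
Unset Strict Implicit.
Unset Printing Implicit Defensive.

Import Order.TTheory GRing.Theory Num.Theory.
Import numFieldNormedType.Exports.

Local Open Scope classical_set_scope.
Local Open Scope ring_scope.

(* Integrals are real-valued Lebesgue integrals ([Rintegral]).  The integral
   from 0 to y is the oriented one, hence the case distinction: [`[0, y]] is
   empty when y < 0. *)
Definition erf (R : realType) (y : R) : R :=
  2 / Num.sqrt pi *
  (if 0 <= y then \int[lebesgue_measure]_(s in `[0, y]) expR (- s ^+ 2)
   else - \int[lebesgue_measure]_(s in `[y, 0]) expR (- s ^+ 2)).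

Definition kappa (R : realType) (eps : R) : R := 1 - eps ^+ 2.

(* Meaningful for t < 0, where it is the centred Gaussian density of variance
   - kappa * t. *)
Definition Phi (R : realType) (eps s t : R) : R :=
  1 / Num.sqrt (- 2 * pi * kappa eps * t) *
  expR (s ^+ 2 / (2 * kappa eps * t)).

Definition phi (R : realType) (eps sigma b y : R) : R :=
  if y <= 0 then - y else y + b * expR (- 2 * eps * y / sigma) - b.

Definition phi_hat (R : realType) (eps sigma b xir t : R) : R :=
  \int[lebesgue_measure]_(s in [set: R])
    (Phi eps (xir - s) t * phi eps sigma b s).

Definition u_h (R : realType) (eps eta z t : R) : R :=
  1 / 2 *
  (eta + \int[lebesgue_measure]_(s in [set: R])
           (Phi eps (z - s) (2 * t) * `|s|)).

Definition u_n (R : realType) (eps sigma b xir t : R) : R :=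
  phi eps sigma b (xir + eps * t) - phi_hat eps sigma b xir t.

(* xi = (xi^h, xi^r) *)
Definition u (R : realType) (eps sigma b eta : R) (xi : R * R) (t : R) : R :=
  u_h eps eta (xi.2 + xi.1) t + u_n eps sigma b xi.2 t.

(* Main.v *)
Require Import Defs.
From mathcomp Require Import all_boot all_order all_algebra.
From mathcomp Require Import all_classical all_reals all_analysis.
From mathcomp Require Import measurable_realfun ring lra.

Set Implicit Arguments.
Unset Strict Implicit.
Unset Printing Implicit Defensive.

Import Order.TTheory GRing.Theory Num.Theory.
Import numFieldNormedType.Exports.

Local Open Scope classical_set_scope.
Local Open Scope ring_scope.

(** Put k = sqrt (1 - eps^2), lambda = 2 eps / sigma = ln ((1 + eps) / (1 - eps)),
    r = lambda / eps.  Both integrals in u are expectations of phi under Gaussian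
    laws (|y| is phi with b = 0), and phi differs from |y| only by
    b (exp (- lambda y) - 1) on y > 0.  Completing the square turns the
    exponential into a shift of the mean, so everything reduces to the integrals
    of p and y p over [0, +oo[ for a Gaussian density p, which have explicit
    antiderivatives in erf and the density.  Since b / sqrt T = 1 / gamma, the
    scaled u is an explicit continuous function of (k, r), and (k, r) tends to
    (1, 2) as eps tends to 0. *)

(** * The error function: derivative, parity and limit at infinity *)

(** Measuring both oriented integrals from [-oo] removes the case distinction on the sign of [y], so
    that the fundamental theorem of calculus applies uniformly. *)
Lemma erfE (R : realType) (y : R) :
  erf y = 2 / Num.sqrt pi *
    (\int[lebesgue_measure]_(t in `]-oo, y]) gauss_fun t -
     \int[lebesgue_measure]_(t in `]-oo, 0]) gauss_fun t).
Proof.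
have ig (b : R) : lebesgue_measure.-integrable `]-oo, b] (EFin \o gauss_fun).
  by apply: integrableS integrableT_gauss.
rewrite /erf; congr (_ * _); case: ifPn => [y0|].
  rewrite (Rintegral_itvB (a := -oo%O) (ig y))// Rintegral_itv_obnd_cbnd//.
  exact: integrableS integrableT_gauss.
rewrite -ltNge => y0; rewrite -[in RHS]opprB; congr (- _).
rewrite (Rintegral_itvB (a := -oo%O) (ig 0)) ?bnd_simp ?(ltW y0)//.
rewrite Rintegral_itv_obnd_cbnd//.
exact: integrableS integrableT_gauss.
Qed.

Lemma is_derive_erf (R : realType) (y : R) :
  is_derive y 1 (@erf R) (2 / Num.sqrt pi * gauss_fun y).
Proof.
have ig (b : R) : lebesgue_measure.-integrable `]-oo, b] (EFin \o gauss_fun).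
  by apply: integrableS integrableT_gauss.
pose G (x : R) := \int[lebesgue_measure]_(t in `]-oo, x]) gauss_fun t.
have [dG G'] : derivable G y 1 /\ derive1 G y = gauss_fun y.
  (* [y + 1] is just some right end beyond [y], making [y] an interior point. *)
  apply: (@continuous_FTC1 _ _ -oo%O _ (y + 1)).
  - by rewrite ltrDl.
  - exact: ig.
  - by rewrite ltNyr.
  - exact: continuous_gauss_fun.
have -> : @erf R = (2 / Num.sqrt pi) \*: (G - cst (G 0)).
  by apply/funext => x; rewrite erfE.
have dG' : is_derive y 1 G (gauss_fun y).
  by apply: DeriveDef => //; rewrite -derive1E.
by apply: is_derive_eq; rewrite subr0.
Qed.

Lemma continuous_erf (R : realType) : continuous (@erf R).
Proof.
move=> y; apply: differentiable_continuous; apply/derivable1_diffP.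
by have [] := is_derive_erf y.
Qed.

Lemma erf0 (R : realType) : erf (0 : R) = 0.
Proof. by rewrite /erf lexx set_itv1 Rintegral_set1 mulr0. Qed.

Lemma erfN (R : realType) (y : R) : erf (- y) = - erf y.
Proof.
wlog y0 : y / 0 < y => [H|].
  have [y0|y0|<-] := ltgtP 0 y; first exact: H.
  - by rewrite -[in RHS](opprK y) (H (- y)) ?oppr_gt0// opprK.
  - by rewrite oppr0 erf0 oppr0.
rewrite /erf oppr_ge0 leNgt y0/= (ltW y0) mulrN; congr (- (_ * _)).
(* The end [0] becomes [- 0], so that the interval is visibly the reflection of [[0, y]]. *)
rewrite /Rintegral -{1}oppr0.
rewrite integration_by_substitution_oppr ?(ltW y0)//; last first.
  exact/continuous_subspaceT/continuous_gauss_fun.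
by congr fine; apply: eq_integral => x _ /=; rewrite sqrrN.
Qed.

(** The square of the Gaussian integral over [[0, x]] tends to [pi / 4]; since the integral is
    nonnegative, taking square roots gives the limit [Num.sqrt pi / 2]. *)
Lemma cvg_erfy (R : realType) : @erf R x @[x --> +oo] --> (1 : R).
Proof.
have sp : 0 < Num.sqrt (pi : R) by rewrite sqrtr_gt0 pi_gt0.
pose I := @gauss_integral_proof.integral0_gauss R.
have cI : I x @[x --> +oo] --> Num.sqrt pi / 2.
  have : Num.sqrt (I x ^+ 2) @[x --> +oo] --> Num.sqrt (pi / 4).
    apply: continuous_cvg; first exact: sqrt_continuous.
    exact: gauss_integral_proof.cvg_integral0_gauss_sqr.
  rewrite sqrtrM ?pi_ge0// sqrtrV// (_ : 4 = 2 ^+ 2); last by rewrite -natrX.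
  rewrite sqrtr_sqr ger0_norm//; apply: cvg_trans.
  apply: near_eq_cvg; near=> x; rewrite sqrtr_sqr// ger0_norm//.
  exact: gauss_integral_proof.integral0_gauss_ge0.
have -> : (1 : R) = 2 / Num.sqrt pi * (Num.sqrt pi / 2).
  by field; rewrite gt_eqF.
have : 2 / Num.sqrt pi * I x @[x --> +oo] --> 2 / Num.sqrt pi * (Num.sqrt pi / 2).
  by apply: cvgMr.
apply: cvg_trans; apply: near_eq_cvg; near=> x.
by rewrite /erf ifT.
Unshelve. all: by end_near. Qed.

(** * Gaussian densities and integration tools on half-lines *)

Lemma integrable_setU (d : measure_display) (T : measurableType d)
    (R : realType) (mu : {measure set T -> \bar R}) (A B : set T)
    (f : T -> \bar R) : measurable A -> measurable B -> [disjoint A & B] ->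
  mu.-integrable A f -> mu.-integrable B f -> mu.-integrable (A `|` B) f.
Proof.
move=> mA mB AB /integrableP[mfA fA] /integrableP[mfB fB].
have mf : measurable_fun (A `|` B) f by apply/measurable_funU.
apply/integrableP; split => //; rewrite ge0_integral_setU//.
  by rewrite lte_add_pinfty.
exact: measurableT_comp.
Qed.

(** For [a > 0] this is the normal density of mean [m] and variance [a ^+ 2 / 2]; this scaling keeps
    factors [Num.sqrt 2] out of the arguments of [erf]. *)
Definition gauss_density (R : realType) (a m y : R) : R :=
  (Num.sqrt pi * a)^-1 * gauss_fun ((y - m) / a).

Lemma gauss_density_ge0 (R : realType) (a m y : R) :
  0 <= a -> 0 <= gauss_density a m y.
Proof.
by move=> a0; rewrite mulr_ge0 ?gauss_fun_ge0// invr_ge0 mulr_ge0.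
Qed.

Lemma continuous_gauss_density (R : realType) (a m : R) :
  continuous (gauss_density a m).
Proof.
move=> y; apply: cvgMr; apply: continuous_comp; last exact: continuous_gauss_fun.
by apply: cvgMl; apply: cvgB => //; exact: cvg_cst.
Qed.

Lemma gauss_densityN (R : realType) (a m y : R) :
  gauss_density a m (- y) = gauss_density a (- m) y.
Proof.
by rewrite /gauss_density /gauss_fun -opprD mulNr sqrrN opprK.
Qed.

(* Completing the square. *)
Lemma expR_gauss_density (R : realType) (a m l y : R) : 0 < a ->
  expR (- (l * y)) * gauss_density a m y =
  expR (l ^+ 2 * a ^+ 2 / 4 - l * m) *
    gauss_density a (m - l * a ^+ 2 / 2) y.
Proof.
move=> a0; rewrite /gauss_density /gauss_fun !(mulrCA (expR _)) -!expRD.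
by congr (_ * expR _); field; rewrite gt_eqF.
Qed.

Lemma is_derive_affine (R : realType) (a m y : R) :
  is_derive y 1 (fun x : R => (x - m) / a) a^-1.
Proof.
have -> : (fun x : R => (x - m) / a) = a^-1 \*: (id - cst m).
  by apply/funext => x /=; rewrite mulrC.
by apply: is_derive_eq; rewrite subr0 [LHS]mulr1.
Qed.

Lemma is_derive_gauss_fun (R : realType) (y : R) :
  is_derive y 1 (@gauss_fun R) (- 2 * y * gauss_fun y).
Proof.
by apply: is_derive_eq; rewrite /gauss_fun /GRing.scale/=; ring.
Qed.

Lemma cvg_affiney (R : realType) (a m : R) : 0 < a ->
  (x - m) / a @[x --> +oo] --> +oo.
Proof.
move=> a0; apply: gt0_cvgMly; first by rewrite invr_gt0.
exact: cvg_addrr.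
Qed.

(** The fundamental theorem for nonnegative integrands gives an extended-real value; its finiteness
    yields integrability as well. *)
Lemma ge0_integral_itvcy (R : realType) (f F : R -> R) (l : R) :
  continuous f -> (forall x, 0 <= x -> 0 <= f x) ->
  (forall x : R, is_derive x 1 F (f x)) -> F x @[x --> +oo] --> l ->
  lebesgue_measure.-integrable `[(0%R : R), +oo[ (EFin \o f) /\
  \int[lebesgue_measure]_(x in `[(0%R : R), +oo[) f x = l - F 0.
Proof.
move=> cf f0 dF Fl.
have I : (\int[lebesgue_measure]_(x in `[(0%R : R), +oo[) (f x)%:E = l%:E - (F 0)%:E)%E.
  apply: ge0_continuous_FTC2y => //.
  - exact: continuous_subspaceT.
  - apply/cvg_at_right_filter/differentiable_continuous/derivable1_diffP.
    by have [] := dF 0.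
  - by move=> x _; rewrite derive1E derive_val.
split; last by rewrite /Rintegral I.
apply/integrableP; split.
  apply/measurable_EFinP; apply: measurable_funTS.
  exact: continuous_measurable_fun.
rewrite -[ltLHS]/(\int[lebesgue_measure]_(x in _) `|f x|%:E)%E.
under eq_integral => x /[!inE]/= /[!in_itv]/= /andP[x0 _] do rewrite ger0_norm ?f0//.
by rewrite I ltry.
Qed.

(** The substitution [x -> - x] carries negative half-line integrals over to those computed by
    antiderivatives on [[0, +oo[]. *)
Lemma ge0_integral_itvNyc (R : realType) (f : R -> R) :
  continuous f -> (forall x, x <= 0 -> 0 <= f x) ->
  lebesgue_measure.-integrable `[(0%R : R), +oo[ (EFin \o (fun x => f (- x))) ->
  lebesgue_measure.-integrable `]-oo, (0%R : R)] (EFin \o f) /\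
  \int[lebesgue_measure]_(x in `]-oo, (0%R : R)]) f x =
  \int[lebesgue_measure]_(x in `[(0%R : R), +oo[) f (- x).
Proof.
move=> cf f0 iF.
have I : (\int[lebesgue_measure]_(x in `]-oo, (0%R : R)]) (f x)%:E =
    \int[lebesgue_measure]_(x in `[(0%R : R), +oo[) (f (- x))%:E)%E.
  rewrite -{1}oppr0 ge0_integration_by_substitutionNy//.
    exact: continuous_subspaceT.
  by move=> x; rewrite oppr0 in_itv/= => /ltW/f0.
split; last by rewrite /Rintegral I.
apply/integrableP; split.
  apply/measurable_EFinP; apply: measurable_funTS.
  exact: continuous_measurable_fun.
rewrite -[ltLHS]/(\int[lebesgue_measure]_(x in _) `|f x|%:E)%E.
under eq_integral => x /[!inE]/= /[!in_itv]/= x0 do rewrite ger0_norm ?f0//.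
rewrite I; have /integrableP[_] := iF; apply: le_lt_trans.
rewrite le_eqVlt; apply/predU1l/eq_integral => x /[!inE]/= /[!in_itv]/= /andP[x0 _].
by rewrite ger0_norm// f0// oppr_le0.
Qed.

(** * Half-line moments of a Gaussian and the expectation of [phi] *)

Lemma integral_gauss_density_itvcy (R : realType) (a m : R) : 0 < a ->
  lebesgue_measure.-integrable `[(0%R : R), +oo[ (EFin \o gauss_density a m) /\
  \int[lebesgue_measure]_(y in `[(0%R : R), +oo[) gauss_density a m y =
    (1 + erf (m / a)) / 2.
Proof.
move=> a0; pose F (y : R) := 2^-1 * erf ((y - m) / a).
have sp : 0 < Num.sqrt (pi : R) by rewrite sqrtr_gt0 pi_gt0.
have dF (y : R) : is_derive y 1 F (gauss_density a m y).
  have d1 := is_derive_affine a m y.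
  have d2 := is_derive_erf ((y - m) / a).
  have d3 := @is_derive1_comp _ (@erf R) (fun x => (x - m) / a) _ _ _ d2 d1.
  have -> : F = 2^-1 \*: (@erf R \o (fun x => (x - m) / a)) by [].
  apply: is_derive_eq; rewrite /gauss_density /GRing.scale/=.
  by field; rewrite !gt_eqF.
have Fl : F x @[x --> +oo] --> (2^-1 * 1 : R).
  apply: cvgMr; exact: cvg_comp (cvg_affiney m a0) (@cvg_erfy R).
have [ig ->] := ge0_integral_itvcy (@continuous_gauss_density R a m)
  (fun y _ => gauss_density_ge0 m y (ltW a0)) dF Fl.
by split => //; rewrite /F sub0r mulNr erfN; field.
Qed.

(** Write [y = m + (y - m)]: the constant part integrates to a multiple of [erf], and [y - m] times
    the density is the derivative of a multiple of the Gaussian itself. *)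
Lemma integral_id_gauss_density_itvcy (R : realType) (a m : R) : 0 < a ->
  lebesgue_measure.-integrable `[(0%R : R), +oo[
    (EFin \o (fun y : R => y * gauss_density a m y)) /\
  \int[lebesgue_measure]_(y in `[(0%R : R), +oo[) (y * gauss_density a m y) =
    m * ((1 + erf (m / a)) / 2) + a / (2 * Num.sqrt pi) * gauss_fun (m / a).
Proof.
move=> a0.
have sp : 0 < Num.sqrt (pi : R) by rewrite sqrtr_gt0 pi_gt0.
pose F (y : R) := m / 2 * erf ((y - m) / a)
  - a / (2 * Num.sqrt pi) * gauss_fun ((y - m) / a).
have dF (y : R) : is_derive y 1 F (y * gauss_density a m y).
  have d1 := is_derive_affine a m y.
  have d2 := is_derive_erf ((y - m) / a).
  have d3 := @is_derive1_comp _ (@erf R) (fun x => (x - m) / a) _ _ _ d2 d1.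
  have d4 := is_derive_gauss_fun ((y - m) / a).
  have d5 := @is_derive1_comp _ (@gauss_fun R) (fun x => (x - m) / a) _ _ _ d4 d1.
  have -> : F = (m / 2) \*: (@erf R \o (fun x => (x - m) / a))
    - (a / (2 * Num.sqrt pi)) \*: (@gauss_fun R \o (fun x => (x - m) / a)) by [].
  apply: is_derive_eq; rewrite /gauss_density /GRing.scale/=.
  by field; rewrite !gt_eqF.
have Fl : F x @[x --> +oo] --> (m / 2 * 1 - a / (2 * Num.sqrt pi) * 0 : R).
  apply: cvgB; apply: cvgMr.
    exact: cvg_comp (cvg_affiney m a0) (@cvg_erfy R).
  exact: cvg_comp (cvg_affiney m a0) (@cvg_gauss_fun R).
have cf : continuous (fun y : R => y * gauss_density a m y).
  by move=> y; apply: cvgM => //; exact: continuous_gauss_density.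
have [ig ->] := ge0_integral_itvcy cf
  (fun y y0 => mulr_ge0 y0 (gauss_density_ge0 m y (ltW a0))) dF Fl.
split => //; rewrite /F sub0r mulNr erfN /gauss_fun sqrrN; field.
by rewrite gt_eqF.
Qed.

(** The line is split at [0], where [phi] changes branch. The terms in [y] of the two halves
    recombine by oddness of [erf]; the factor of [b] comes from the positive half alone. *)
Lemma integral_gauss_density_phi (R : realType) (a m eps sigma b : R) :
  0 < a ->
  let l := 2 * eps / sigma in
  \int[lebesgue_measure]_(y in [set: R])
    (gauss_density a m y * phi eps sigma b y) =
  m * erf (m / a) + a / Num.sqrt pi * gauss_fun (m / a)
  + b * (expR (l ^+ 2 * a ^+ 2 / 4 - l * m)
           * ((1 + erf ((m - l * a ^+ 2 / 2) / a)) / 2)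
         - (1 + erf (m / a)) / 2).
Proof.
move=> a0 l.
have sp : 0 < Num.sqrt (pi : R) by rewrite sqrtr_gt0 pi_gt0.
pose h := fun y => gauss_density a m y * phi eps sigma b y.
(* [m'] and [q] are the shifted mean and the prefactor produced by completing the square in
   [expR (- (l * y))] times the density. *)
pose m' := m - l * a ^+ 2 / 2.
pose q := expR (l ^+ 2 * a ^+ 2 / 4 - l * m).
have [i0 e0] := integral_gauss_density_itvcy m a0.
have [i0' e0'] := integral_gauss_density_itvcy m' a0.
have [i1 e1] := integral_id_gauss_density_itvcy m a0.
(* The mean [- m] arises from reflecting the negative half-line. *)
have [i1' e1'] := integral_id_gauss_density_itvcy (- m) a0.
have [iN eN] : lebesgue_measure.-integrable `]-oo, (0%R : R)] (EFin \o h) /\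
    \int[lebesgue_measure]_(y in `]-oo, (0%R : R)]) h y =
    - m * ((1 + erf (- m / a)) / 2)
      + a / (2 * Num.sqrt pi) * gauss_fun (- m / a).
  have [|||iG eG] := @ge0_integral_itvNyc R (fun y : R => - y * gauss_density a m y).
  - by move=> y; apply: cvgM; [exact: cvgN|exact: continuous_gauss_density].
  - by move=> y y0; rewrite mulr_ge0 ?oppr_ge0// gauss_density_ge0// ltW.
  - apply: eq_integrable i1' => // y _ /=.
    by rewrite opprK gauss_densityN.
  have hE : {in `]-oo, (0%R : R)]%classic, h =1 (fun y : R => - y * gauss_density a m y)}.
    move=> y /[!inE]/= /[!in_itv]/= y0.
    by rewrite /h /phi y0 mulrC.
  split; first by apply: eq_integrable iG => // y /hE /= ->.
  apply: etrans; first by apply: eq_Rintegral; exact: hE.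
  rewrite eG -e1'; apply: eq_Rintegral => y _.
  by rewrite opprK gauss_densityN.
pose p (y : R) := y * gauss_density a m y
  + b * (q * gauss_density a m' y - gauss_density a m y).
have hE : {in `](0%R : R), +oo[%classic, h =1 p}.
  move=> y /[!inE]/= /[!in_itv]/= /andP[y0 _].
  rewrite /h /phi leNgt y0 /= /p -expR_gauss_density//.
  have -> : - 2 * eps * y / sigma = - (l * y) by rewrite /l; ring.
  by ring.
have iq : lebesgue_measure.-integrable `[(0%R : R), +oo[
    (EFin \o (fun y : R => q * gauss_density a m' y)).
  apply: eq_integrable (integrableZl _ q i0') => //.
have id : lebesgue_measure.-integrable `[(0%R : R), +oo[
    (EFin \o (fun y : R => q * gauss_density a m' y - gauss_density a m y)).
  by apply: eq_integrable (integrableB _ iq i0).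
have ib : lebesgue_measure.-integrable `[(0%R : R), +oo[ (EFin \o
    (fun y : R => b * (q * gauss_density a m' y - gauss_density a m y))).
  by apply: eq_integrable (integrableZl _ b id).
have ip : lebesgue_measure.-integrable `[(0%R : R), +oo[ (EFin \o p).
  by apply: eq_integrable (integrableD _ i1 ib).
have ip' : lebesgue_measure.-integrable `](0%R : R), +oo[ (EFin \o p).
  by apply: integrableS ip => //; apply: subset_itvr; rewrite bnd_simp.
have ih : lebesgue_measure.-integrable `](0%R : R), +oo[ (EFin \o h).
  by apply: eq_integrable ip' => // y /hE /= ->.
have eP : \int[lebesgue_measure]_(y in `](0%R : R), +oo[) h y =
    m * ((1 + erf (m / a)) / 2) + a / (2 * Num.sqrt pi) * gauss_fun (m / a)
    + b * (q * ((1 + erf (m' / a)) / 2) - (1 + erf (m / a)) / 2).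
  apply: etrans; first by apply: eq_Rintegral; exact: hE.
  (* The endpoint [0] is a null set, so the moments over the closed half-line apply. *)
  rewrite Rintegral_itv_obnd_cbnd//.
  by rewrite RintegralD// RintegralZl// RintegralB// RintegralZl// e1 e0 e0'.
have TE : [set: R] = `]-oo, (0%R : R)] `|` `](0%R : R), +oo[.
  by rewrite -setCitvl setUv.
rewrite TE Rintegral_setU//; last 2 first.
- by apply: integrable_setU => //; rewrite -setCitvl; apply/disj_setPCl.
- by rewrite -setCitvl; apply/disj_setPCl.
rewrite eN eP !mulNr erfN /gauss_fun sqrrN -/m' -/q; field.
by rewrite gt_eqF.
Qed.

(** * Closed forms for the heat-kernel integrals and for the scaled [u] *)

(** The variance [- kappa eps * t] must equal [a ^+ 2 / 2], which dictates the choice of [a]. *)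
Lemma Phi_gauss_density (R : realType) (eps z y t : R) :
  0 < kappa eps -> t < 0 ->
  Phi eps (z - y) t = gauss_density (Num.sqrt (- 2 * kappa eps * t)) z y.
Proof.
move=> k0 t0; have v0 : 0 < - 2 * kappa eps * t.
  by rewrite mulNr mulNr -mulrN !mulr_gt0// oppr_gt0.
rewrite /Phi /gauss_density /gauss_fun; congr (_ * expR _).
  rewrite -sqrtrM ?pi_ge0// div1r; congr (Num.sqrt _)^-1; ring.
rewrite expr_div_n sqr_sqrtr ?ltW//; field.
by rewrite (lt_eqF t0) (gt_eqF k0).
Qed.

Lemma phi_normr (R : realType) (eps sigma y : R) : phi eps sigma 0 y = `|y|.
Proof.
rewrite /phi mul0r addr0 subr0.
by have [y0|y0] := leP y 0; [rewrite ler0_norm|rewrite gtr0_norm].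
Qed.

Lemma phi_hatE (R : realType) (eps sigma b z t : R) :
  0 < kappa eps -> t < 0 ->
  let a := Num.sqrt (- 2 * kappa eps * t) in
  let l := 2 * eps / sigma in
  phi_hat eps sigma b z t =
  z * erf (z / a) + a / Num.sqrt pi * gauss_fun (z / a)
  + b * (expR (l ^+ 2 * a ^+ 2 / 4 - l * z)
           * ((1 + erf ((z - l * a ^+ 2 / 2) / a)) / 2)
         - (1 + erf (z / a)) / 2).
Proof.
move=> k0 t0 a l; rewrite -integral_gauss_density_phi; last first.
  by rewrite sqrtr_gt0 mulNr mulNr -mulrN !mulr_gt0// oppr_gt0.
by apply: eq_Rintegral => y _; rewrite Phi_gauss_density.
Qed.

Lemma u_hE (R : realType) (eps z t : R) : 0 < kappa eps -> t < 0 ->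
  let a := Num.sqrt (- 4 * kappa eps * t) in
  u_h eps 0 z t =
  1 / 2 * (z * erf (z / a) + a / Num.sqrt pi * gauss_fun (z / a)).
Proof.
move=> k0 t0 a; have t20 : 2 * t < 0 by rewrite pmulr_rlt0.
rewrite /u_h add0r; congr (_ * _).
(* With [b = 0] the function [phi] is the absolute value for any [sigma]; [1] is an arbitrary
   choice. The doubled time turns the factor [- 2] in the width into [- 4]. *)
transitivity (phi_hat eps 1 0 z (2 * t)).
  by apply: eq_Rintegral => y _; rewrite phi_normr.
rewrite phi_hatE// mul0r addr0 (_ : - 2 * _ * _ = - 4 * kappa eps * t)//.
by ring.
Qed.

(* [r] stands for [2 / sigma], so the phi_hat tilt has rate [2 * eps / sigma = r * eps]. *)
Lemma u_scaled (R : realType) (gamma eps : R) : 0 < gamma -> 0 < eps < 1 ->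
  let T := (gamma / eps) ^+ 2 in
  let k := Num.sqrt (1 - eps ^+ 2) in
  let L := ln ((1 + eps) / (1 - eps)) in
  let r := eps^-1 * L in
  1 / (gamma / eps) * u eps (2 * eps / L) (1 / eps) 0 (eps * T, eps * T) (- T) =
  gamma * erf (gamma / k) + k / Num.sqrt pi * gauss_fun (gamma / k)
  - (gamma * erf (gamma / (Num.sqrt 2 * k))
     + Num.sqrt 2 * k / Num.sqrt pi * gauss_fun (gamma / (Num.sqrt 2 * k))
     + 1 / gamma * (expR (r ^+ 2 * k ^+ 2 * gamma ^+ 2 / 2 - r * gamma ^+ 2)
         * ((1 + erf ((gamma - r * k ^+ 2 * gamma) / (Num.sqrt 2 * k))) / 2)
         - (1 + erf (gamma / (Num.sqrt 2 * k))) / 2)).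
Proof.
move=> g0 /andP[e0 e1] T k L r.
have K0 : 0 < kappa eps by rewrite /kappa subr_gt0 expr_lt1// ltW.
have k0 : 0 < k by rewrite sqrtr_gt0.
have kE : k ^+ 2 = kappa eps by rewrite sqr_sqrtr// ltW.
have T0 : - T < 0 by rewrite oppr_lt0 exprn_gt0// divr_gt0.
have L0 : 0 < L.
  by apply: ln_gt0; rewrite ltr_pdivlMr ?subr_gt0// mul1r; lra.
have s0 : 0 < Num.sqrt (2 : R) by rewrite sqrtr_gt0.
have s2 : Num.sqrt (2 : R) ^+ 2 = 2 by rewrite sqr_sqrtr.
have sp : 0 < Num.sqrt (pi : R) by rewrite sqrtr_gt0 pi_gt0.
(* The two Gaussian widths, for times [- T] and [- 2 T], become rational in [k], [gamma] and [eps]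
   because [T] is a square. *)
have aE : Num.sqrt (- 2 * kappa eps * - T) = Num.sqrt 2 * k * gamma / eps.
  rewrite (_ : _ * - T = (Num.sqrt 2 * k * gamma / eps) ^+ 2).
    by rewrite sqrtr_sqr ger0_norm// ltW// divr_gt0// !mulr_gt0.
  by rewrite !(expr_div_n, exprMn) s2 kE /T expr_div_n; field; rewrite gt_eqF.
have aE' : Num.sqrt (- 4 * kappa eps * - T) = 2 * k * gamma / eps.
  rewrite (_ : _ * - T = (2 * k * gamma / eps) ^+ 2).
    by rewrite sqrtr_sqr ger0_norm// ltW// divr_gt0// !mulr_gt0.
  by rewrite !(expr_div_n, exprMn) kE /T expr_div_n; field; rewrite gt_eqF.
have lE : 2 * eps / (2 * eps / L) = r * eps by rewrite /r; field; rewrite !gt_eqF.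
rewrite /u /u_n /= u_hE// phi_hatE// aE aE' lE.
(* The argument [eps * T + eps * - T] is [0], which falls in the first branch of [phi]. *)
rewrite (_ : phi _ _ _ _ = 0); last first.
  by rewrite /phi mulrN subrr lexx oppr0.
have -> : (eps * T + eps * T) / (2 * k * gamma / eps) = gamma / k.
  by rewrite /T; field; rewrite !gt_eqF.
have -> : eps * T / (Num.sqrt 2 * k * gamma / eps) = gamma / (Num.sqrt 2 * k).
  by rewrite /T; field; rewrite !gt_eqF.
have aq : (Num.sqrt 2 * k * gamma / eps) ^+ 2 = 2 * k ^+ 2 * gamma ^+ 2 / eps ^+ 2.
  by rewrite !(expr_div_n, exprMn) s2.
have -> : (eps * T - r * eps * (Num.sqrt 2 * k * gamma / eps) ^+ 2 / 2) /
    (Num.sqrt 2 * k * gamma / eps) =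
    (gamma - r * k ^+ 2 * gamma) / (Num.sqrt 2 * k).
  by rewrite aq /T; field; rewrite !gt_eqF.
have -> : (r * eps) ^+ 2 * (Num.sqrt 2 * k * gamma / eps) ^+ 2 / 4
    - r * eps * (eps * T) = r ^+ 2 * k ^+ 2 * gamma ^+ 2 / 2 - r * gamma ^+ 2.
  by rewrite aq /T; field; rewrite !gt_eqF.
by rewrite /T; field; rewrite !gt_eqF.
Qed.

(** * Passage to the limit *)

(** The expression is the difference quotient at [0] of [ln (1 + x) - ln (1 - x)], whose derivative
    there is [1 + 1]. *)
Lemma cvg_ln_ratio (R : realType) :
  eps^-1 * ln ((1 + eps) / (1 - eps)) @[eps --> (0 : R)^'+] --> (2 : R).
Proof.
pose f (x : R) := ln (1 + x) - ln (1 - x).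
have df : is_derive (0 : R) 1 f 2.
  have d1 : is_derive (0 : R) 1 (fun x : R => 1 + x) 1.
    by apply: is_derive_eq; ring.
  have d2 : is_derive (0 : R) 1 (fun x : R => 1 - x) (- 1).
    by apply: is_derive_eq; ring.
  have l1 : is_derive (1 + 0 : R) 1 (@ln R) 1.
    by rewrite addr0 -[X in is_derive _ _ _ X]invr1; exact: is_derive1_ln.
  have l2 : is_derive (1 - 0 : R) 1 (@ln R) 1.
    by rewrite subr0 -[X in is_derive _ _ _ X]invr1; exact: is_derive1_ln.
  have c1 := @is_derive1_comp _ (@ln R) (fun x => 1 + x) _ _ _ l1 d1.
  have c2 := @is_derive1_comp _ (@ln R) (fun x => 1 - x) _ _ _ l2 d2.
  have -> : f = (@ln R \o (fun x => 1 + x)) - (@ln R \o (fun x => 1 - x)) by [].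
  by apply: is_derive_eq; ring.
(* The derivative is unfolded into the limit of its difference quotient, then restricted to positive
   increments. *)
have [/cvg_ex[l fl] dE] := df.
have lE : l = 2 by rewrite -dE; apply/esym/cvg_lim.
have := cvg_dnbhs_at_right fl; rewrite lE.
apply: cvg_trans; apply: near_eq_cvg; near=> e.
have e0 : 0 < e by [].
have e1 : e < 1 by near: e; exact: nbhs_right_lt.
rewrite /= addr0 [e *: _]mulr1 /f subr0 addr0 ln1 subr0 subr0 /GRing.scale/=.
by rewrite ln_div// posrE; lra.
Unshelve. all: by end_near. Qed.

Lemma cvg_sqrt_kappa (R : realType) :
  Num.sqrt (1 - eps ^+ 2) @[eps --> (0 : R)^'+] --> (1 : R).
Proof.
have : Num.sqrt (1 - eps ^+ 2) @[eps --> (0 : R)] --> Num.sqrt (1 - 0 ^+ 2 : R).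
  apply: continuous_cvg; first exact: sqrt_continuous.
  by apply: cvgB; [exact: cvg_cst|exact: exprn_continuous].
by rewrite expr0n subr0 sqrtr1; exact: cvg_at_right_filter.
Qed.

(** Continuity in [k] and [r] reduces the limit to the value at [k = 1], [r = 2]. *)
Lemma cvg_scaled_u (R : realType) (gamma : R) (F : set_system R)
    (FF : ProperFilter F) (k r : R -> R) : 0 < gamma ->
  k e @[e --> F] --> (1 : R) -> r e @[e --> F] --> (2 : R) ->
  gamma * erf (gamma / k e) + k e / Num.sqrt pi * gauss_fun (gamma / k e)
  - (gamma * erf (gamma / (Num.sqrt 2 * k e))
     + Num.sqrt 2 * k e / Num.sqrt pi * gauss_fun (gamma / (Num.sqrt 2 * k e))
     + 1 / gamma * (expR (r e ^+ 2 * k e ^+ 2 * gamma ^+ 2 / 2 - r e * gamma ^+ 2)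
         * ((1 + erf ((gamma - r e * k e ^+ 2 * gamma) / (Num.sqrt 2 * k e))) / 2)
         - (1 + erf (gamma / (Num.sqrt 2 * k e))) / 2))
  @[e --> F] -->
  1 / Num.sqrt pi * expR (- gamma ^+ 2) + gamma * erf gamma
  + (1 / gamma - gamma) * erf (gamma / Num.sqrt 2)
  - Num.sqrt (2 / pi) * expR (- (gamma ^+ 2 / 2)).
Proof.
move=> g0 ck cr.
have s0 : 0 < Num.sqrt (2 : R) by rewrite sqrtr_gt0.
have s2 : Num.sqrt (2 : R) ^+ 2 = 2 by rewrite sqr_sqrtr.
have sp : 0 < Num.sqrt (pi : R) by rewrite sqrtr_gt0 pi_gt0.
have ck2 : k e ^+ 2 @[e --> F] --> (1 ^+ 2 : R) by exact: cvgM.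
have cr2 : r e ^+ 2 @[e --> F] --> (2 ^+ 2 : R) by exact: cvgM.
have cv : gamma / k e @[e --> F] --> gamma / 1.
  by apply: cvgMr; apply: cvgV => //; exact: oner_neq0.
have cw : gamma / (Num.sqrt 2 * k e) @[e --> F] --> gamma / (Num.sqrt 2 * 1).
  by apply: cvgMr; apply: cvgV; [rewrite mulr1 gt_eqF|exact: cvgMr].
have cx : (gamma - r e * k e ^+ 2 * gamma) / (Num.sqrt 2 * k e) @[e --> F] -->
    (gamma - 2 * 1 ^+ 2 * gamma) / (Num.sqrt 2 * 1).
  apply: cvgM; last by apply: cvgV; [rewrite mulr1 gt_eqF|exact: cvgMr].
  by apply: cvgB; [exact: cvg_cst|apply: cvgMl; exact: cvgM].
have cq : r e ^+ 2 * k e ^+ 2 * gamma ^+ 2 / 2 - r e * gamma ^+ 2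
    @[e --> F] --> 2 ^+ 2 * 1 ^+ 2 * gamma ^+ 2 / 2 - 2 * gamma ^+ 2.
  by apply: cvgB; [do 2 apply: cvgMl; exact: cvgM|exact: cvgMl].
have cE (h : R -> R) (x : R) : h e @[e --> F] --> x ->
    erf (h e) @[e --> F] --> erf x.
  by move=> hx; apply: continuous_cvg => //; exact: continuous_erf.
have cG (h : R -> R) (x : R) : h e @[e --> F] --> x ->
    gauss_fun (h e) @[e --> F] --> gauss_fun x.
  by move=> hx; apply: continuous_cvg => //; exact: continuous_gauss_fun.
have -> : 1 / Num.sqrt pi * expR (- gamma ^+ 2) + gamma * erf gamma
  + (1 / gamma - gamma) * erf (gamma / Num.sqrt 2)
  - Num.sqrt (2 / pi) * expR (- (gamma ^+ 2 / 2)) =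
  gamma * erf (gamma / 1) + 1 / Num.sqrt pi * gauss_fun (gamma / 1)
  - (gamma * erf (gamma / (Num.sqrt 2 * 1))
     + Num.sqrt 2 * 1 / Num.sqrt pi * gauss_fun (gamma / (Num.sqrt 2 * 1))
     + 1 / gamma * (expR (2 ^+ 2 * 1 ^+ 2 * gamma ^+ 2 / 2 - 2 * gamma ^+ 2)
         * ((1 + erf ((gamma - 2 * 1 ^+ 2 * gamma) / (Num.sqrt 2 * 1))) / 2)
         - (1 + erf (gamma / (Num.sqrt 2 * 1))) / 2)).
  (* At [r = 2] the exponent vanishes and the shifted mean is exactly [- gamma], so the factor of
     [1 / gamma] collapses to [- erf (gamma / Num.sqrt 2)]. *)
  rewrite (_ : 2 ^+ 2 * _ * _ / 2 - _ = 0) ?expR0; last by field.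
  rewrite (_ : gamma - _ = - gamma); last by ring.
  rewrite mulNr erfN /gauss_fun !mulr1 divr1 expr_div_n s2.
  rewrite sqrtrM// sqrtrV ?pi_ge0//.
  by field; rewrite !gt_eqF.
apply: cvgB.
  apply: cvgD; first by apply: cvgMr; exact: (cE _ _ cv).
  by apply: cvgM; [exact: cvgMl|exact: (cG _ _ cv)].
apply: cvgD.
  apply: cvgD; first by apply: cvgMr; exact: (cE _ _ cw).
  by apply: cvgM; [apply: cvgMl; exact: cvgMr|exact: (cG _ _ cw)].
apply: cvgMr; apply: cvgB.
  apply: cvgM; last first.
    by apply: cvgMl; apply: cvgD; [exact: cvg_cst|exact: (cE _ _ cx)].
  by apply: continuous_cvg; [exact: continuous_expR|exact: cq].
by apply: cvgMl; apply: cvgD; [exact: cvg_cst|exact: (cE _ _ cw)].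
Qed.

Unset Implicit Arguments.

Theorem mainTheorem5 (R : realType) (gamma : R) (T : R -> R)
    (gamma_gt0 : 0 < gamma)
    (TE : forall eps : R, 0 < eps < 1 -> gamma = eps * Num.sqrt (T eps)) :
  1 / Num.sqrt (T eps) *
    u eps (2 * eps / ln ((1 + eps) / (1 - eps))) (1 / eps)
      0 (eps * T eps, eps * T eps) (- T eps)
    @[eps --> 0^'+] -->
  1 / Num.sqrt pi * expR (- gamma ^+ 2) + gamma * erf gamma
  + (1 / gamma - gamma) * erf (gamma / Num.sqrt 2)
  - Num.sqrt (2 / pi) * expR (- (gamma ^+ 2 / 2)).
Proof.
have L := cvg_scaled_u (at_right_proper_filter (0 : R)) gamma_gt0 (@cvg_sqrt_kappa R) (@cvg_ln_ratio R).
apply: cvg_trans L; apply: near_eq_cvg; near=> e.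
have e0 : 0 < e by [].
have e1 : e < 1 by near: e; exact: nbhs_right_lt.
have e01 : 0 < e < 1 by rewrite e0.
have sT : Num.sqrt (T e) = gamma / e.
  by rewrite (TE _ e01) mulrAC divff ?mul1r// gt_eqF.
have TT : T e = (gamma / e) ^+ 2.
  (* [Num.sqrt] is [0] on nonpositive reals, so a negative [T e] would contradict
     [gamma / e > 0]. *)
  rewrite -sT sqr_sqrtr// leNgt; apply/negP => /ltW/ler0_sqrtr T0.
  by have := divr_gt0 gamma_gt0 e0; rewrite -sT T0 ltxx.
by rewrite sT TT u_scaled.
Unshelve. all: by end_near. Qed.
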